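(* For all integers $n\ge 0$, \begin{align*} A_3(27n+26)&\equiv 0\pmod{12},\\ A_9(27n+24)&\equiv 0\pmod{24}. \end{align*}
   Context: An overpartition of a nonnegative integer $n$ is a partition of $n$ in which the first occurrence of each part size may or may not be overlined. For a positive integer $m$, $A_m(n)$ denotes the number of overpartitions of $n$ in which only the parts not divisible by $m$ may be overlined. Its generating function is $$\sum_{n=0}^{\infty}A_m(n)q^n = \frac{(q^{2};q^{2})_{\infty}(q^m;q^m)_{\infty}}{(q;q)^2_{\infty}(q^{2m};q^{2m})_{\infty}},$$ where $(q^a;q^b)_{\infty} := \prod_{k=0}^{\infty}(1-q^{bk+a})$. *)

(* Defs.v *)
From mathcomp Require Import all_boot.

Set Implicit Arguments.
Unset Strict Implicit.
Unset Printing Implicit Defensive.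

(* A part is a pair (size, overlined?).  In the last conjunct, an overlined
   part differs in size from every earlier part: it is the first occurrence
   of its size. *)
Definition is_overpartition (n : nat) (s : seq (nat * bool)) : bool :=
  [&& all (leq 1) (unzip1 s),
      sorted geq (unzip1 s),
      sumn (unzip1 s) == n
    & pairwise [rel x y : nat * bool | y.2 ==> (x.1 != y.1)] s].

Definition overlined_nondvd (m : nat) (s : seq (nat * bool)) : bool :=
  all [pred x : nat * bool | x.2 ==> ~~ (m %| x.1)] s.

Definition parts_of n (s : n.-bseq ('I_n.+1 * bool)) : seq (nat * bool) :=
  [seq (val x.1, x.2) | x : 'I_n.+1 * bool <- s].

(* The bounds of the finite type n.-bseq ('I_n.+1 * bool) exclude no
   overpartition of n: see parts_of_inj and overpartition_parts_of. *)
Definition A (m n : nat) : nat :=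
  #|[set s : n.-bseq ('I_n.+1 * bool) |
      is_overpartition n (parts_of s) && overlined_nondvd m (parts_of s)]|.

Lemma parts_of_inj n : injective (@parts_of n).
Proof.
move=> s t st; apply/val_inj; apply: inj_map st => -[i a] [j b] [ij ->].
by congr (_, _); apply: val_inj.
Qed.

Lemma overpartition_parts_of n s :
  is_overpartition n s -> exists t : n.-bseq ('I_n.+1 * bool), parts_of t = s.
Proof.
case/and4P => pos _ /eqP sum_s _.
have szs : size s <= n.
  rewrite -sum_s; elim: s pos {sum_s} => //= x s IHs /andP[x0 /IHs].
  by rewrite -add1n; apply: leq_add.
have bnd : all (fun x : nat * bool => x.1 <= n) s.
  rewrite -sum_s; elim: s {pos sum_s szs} => //= x s IHs.
  rewrite leq_addr /=; apply: sub_all IHs => y /leq_trans; apply.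
  exact: leq_addl.
pose f (x : nat * bool) := (inord x.1 : 'I_n.+1, x.2).
have szt : size (map f s) <= n by rewrite size_map.
exists (Bseq szt); rewrite /parts_of /= -map_comp.
apply: map_id_in => -[i b] /(allP bnd) /= i_le.
by rewrite /f /= inordK.
Qed.

(* Main.v *)
Require Import Defs.
From mathcomp Require Import all_boot.
From HB Require Import structures.
From mathcomp Require Import all_algebra ring zify.
From mathcomp Require boolp.

Set Implicit Arguments.
Unset Strict Implicit.
Unset Printing Implicit Defensive.

Import GRing.Theory.

(** Let G_m be the generating function of A m, and put D = (1-q)(1-q^2)... and
    P = (1+q)(1+q^2)... .  Removing the largest part of an overpartition gives
    the product formula G_m D P(q^m) = P (genA_prod).  Two identities of Gauss
    turn the products into lacunary series:
<<
      phi = D / P   = sum over k in Z of (-1)^k q^(k^2),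
      psi = D P^2   = sum over k >= 0 of q^(k(k+1)/2).
>>
    Both are limits of exact finite identities (gauss_square_partial and
    gauss_triangular_partial), which telescope in the manner of Shanks.

    Powers of 2.  The product formula now reads G_m phi P(q^m) = 1, so that on
    a residue class modulo m the series G_m vanishes as soon as 1 / phi does
    (extract_genA_eq0).  As phi is 1 modulo 2, its inverse is 2 - phi modulo 4
    and 3 - 3 phi + phi^2 modulo 8.  Since 2 is not a square modulo 3, and 6 is
    not a sum of two squares modulo 9, A_3(3n+2) is divisible by 4 and
    A_9(9n+6) by 8.

    Modulo 3.  Cubing a product such as D or P is the substitution q -> q^3, so
    the product formula becomes G_3 = 1 / psi and G_9 = phi^2 / psi(q^3).
    Multiplying by psi^3 = psi(q^3) replaces a denominator psi by a series in
    q^3, which the extraction of an arithmetic progression of exponents leaves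
    alone.  Triangular numbers are never 2 modulo 3, and those that are 1
    modulo 3 are the 9t+1 with t triangular; squares are never 2 modulo 3, and
    those divisible by 3 are the 9t with t a square.  This gives, modulo 3,
<<
      sum of A_3(9n+8) q^n = psi psi(q^3)^2,
      sum of A_9(9n+6) q^n = psi psi(q^3)^2 / P(q^3)^2,
>>
    and in both right-hand sides psi is multiplied by a series in q^3, so that
    no exponent 3n+2 occurs.

    The identities are proved for power series over an arbitrary commutative
    ring R; the congruences are obtained with R = Z/4, Z/8 and Z/3. *)

(** * Formal power series *)

Record fps (R : Type) := Fps { coef : nat -> R }.

Section PowerSeriesRing.

Local Open Scope ring_scope.

Variable R : comNzRingType.
Implicit Types f g h : fps R.

Lemma fpsP f g : (forall n, coef f n = coef g n) -> f = g.
Proof. by case: f g => [f] [g] /boolp.funext /= ->. Qed.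

HB.instance Definition _ := boolp.gen_eqMixin (fps R).
HB.instance Definition _ := boolp.gen_choiceMixin (fps R).

Definition fps_add f g := Fps (fun n => coef f n + coef g n).
Definition fps_opp f := Fps (fun n => - coef f n).
Definition fps_zero : fps R := Fps (fun=> 0).

Lemma fps_addA : associative fps_add.
Proof. by move=> f g h; apply: fpsP => n; apply: addrA. Qed.

Lemma fps_addC : commutative fps_add.
Proof. by move=> f g; apply: fpsP => n; apply: addrC. Qed.

Lemma fps_add0 : left_id fps_zero fps_add.
Proof. by move=> f; apply: fpsP => n; apply: add0r. Qed.

Lemma fps_addN : left_inverse fps_zero fps_opp fps_add.
Proof. by move=> f; apply: fpsP => n; apply: addNr. Qed.

HB.instance Definition _ :=
  GRing.isZmodule.Build (fps R) fps_addA fps_addC fps_add0 fps_addN.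

Definition fps_mul f g :=
  Fps (fun n => \sum_(i < n.+1) coef f i * coef g (n - i)%N).
Definition fps_one : fps R := Fps (fun n => (n == 0%N)%:R).

(** The ring laws are inherited from polynomials: the coefficient of degree n
    of a product only depends on the factors truncated at any degree N >= n. *)
Definition trunc N f : {poly R} := \poly_(i < N.+1) coef f i.

Lemma coef_trunc N f n : (n <= N)%N -> (trunc N f)`_n = coef f n.
Proof. by move=> le_nN; rewrite coef_poly ltnS le_nN. Qed.

Lemma coef_fps_mul N f g n :
  (n <= N)%N -> coef (fps_mul f g) n = (trunc N f * trunc N g)`_n.
Proof.
move=> le_nN; rewrite coefM; apply: eq_bigr => i _.
have le_in : (i <= n)%N by rewrite -ltnS.
by rewrite !coef_trunc ?(leq_trans (leq_subr _ _)) ?(leq_trans le_in).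
Qed.

Lemma eq_coefM (p p' q q' : {poly R}) n :
    (forall i, (i <= n)%N -> p`_i = p'`_i) ->
    (forall i, (i <= n)%N -> q`_i = q'`_i) ->
  (p * q)`_n = (p' * q')`_n.
Proof.
move=> eq_p eq_q; rewrite !coefM; apply: eq_bigr => i _.
by rewrite eq_p -1?ltnS // eq_q ?leq_subr.
Qed.

Lemma fps_mulA : associative fps_mul.
Proof.
move=> f g h; apply: fpsP => n; rewrite !(@coef_fps_mul n) //.
have tr u v i : (i <= n)%N ->
  (trunc n (fps_mul u v))`_i = (trunc n u * trunc n v)`_i.
  by move=> le_in; rewrite coef_trunc // (@coef_fps_mul n).
rewrite (eq_coefM (fun i _ => erefl) (tr g h)) mulrA.
by apply: eq_coefM => // i le_in; rewrite tr.
Qed.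

Lemma fps_mulC : commutative fps_mul.
Proof. by move=> f g; apply: fpsP => n; rewrite !(@coef_fps_mul n) // mulrC. Qed.

Lemma fps_mul1 : left_id fps_one fps_mul.
Proof.
move=> f; apply: fpsP => n /=; rewrite big_ord_recl /= subn0 mul1r big1 ?addr0 //.
by move=> i _; rewrite mul0r.
Qed.

Lemma fps_mulDl : left_distributive fps_mul fps_add.
Proof.
move=> f g h; apply: fpsP => n /=; rewrite -big_split /=.
by apply: eq_bigr => i _; rewrite mulrDl.
Qed.

Lemma fps_one_neq0 : fps_one != 0.
Proof.
apply/eqP => /(congr1 (fun f => coef f 0)) /= /eqP; apply/negP.
exact: oner_neq0.
Qed.

HB.instance Definition _ := GRing.Zmodule_isComNzRing.Build (fps R)
  fps_mulA fps_mulC fps_mul1 fps_mulDl fps_one_neq0.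

Lemma fps_coefD f g n : coef (f + g) n = coef f n + coef g n.
Proof. by []. Qed.

Lemma fps_coefN f n : coef (- f) n = - coef f n.
Proof. by []. Qed.

Lemma fps_coef1 n : coef (1 : fps R) n = (n == 0%N)%:R.
Proof. by []. Qed.

Lemma fps_coefM f g n : coef (f * g) n = \sum_(i < n.+1) coef f i * coef g (n - i).
Proof. by []. Qed.

Lemma fps_coef_sum I (r : seq I) (P : pred I) (F : I -> fps R) n :
  coef (\sum_(i <- r | P i) F i) n = \sum_(i <- r | P i) coef (F i) n.
Proof. by elim/big_rec2: _ => // i _ y _ <-. Qed.

Lemma fps_coefMn f k n : coef (f *+ k) n = coef f n *+ k.
Proof. by elim: k => // k IHk; rewrite !mulrS -IHk. Qed.

Lemma coef0X f n : coef f 0 = 1 -> coef (f ^+ n) 0 = 1.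
Proof.
move=> f0; elim: n => // n IHn.
by rewrite exprS fps_coefM big_ord_recl big_ord0 f0 IHn mulr1 addr0.
Qed.

(** A series with constant term 1 is cancellable over any coefficient ring. *)
Lemma mul_fps_inj f : coef f 0 = 1 -> injective ( *%R f).
Proof.
move=> f0 g h /eqP; rewrite -subr_eq0 -mulrBr => /eqP fgh.
apply/eqP; rewrite -subr_eq0; apply/eqP; move: (g - h) fgh => {}g fg0.
apply: fpsP => n; have [m] := ubnP n; elim: m n => // m IHm n lt_nm.
have := congr1 (fun u => coef u n) fg0.
rewrite fps_coefM big_ord_recl /= f0 mul1r subn0 big1 ?addr0 // => i _.
have lt_0n : (0 < n)%N by case: (n) i => [[]|].
by rewrite IHm ?mulr0 // (leq_trans _ (lt_nm : (n <= m)%N)) // ltn_subrL.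
Qed.

Definition monom k : fps R := Fps (fun n => (n == k)%:R).
Local Notation "''q^' k" :=
  (monom k%N) (at level 3, k at level 2, format "''q^' k").

Lemma coef_monomM k f n :
  coef ('q^k * f) n = if (k <= n)%N then coef f (n - k) else 0.
Proof.
rewrite fps_coefM; case: leqP => [le_kn | lt_nk]; last first.
  rewrite big1 // => i _; rewrite /= (_ : (_ == _) = false) ?mul0r //.
  by apply/negbTE; rewrite neq_ltn (leq_trans _ lt_nk).
have lt_kn : (k < n.+1)%N by [].
rewrite (bigD1 (Ordinal lt_kn)) //= eqxx mul1r big1 ?addr0 // => i.
by rewrite -val_eqE /= => /negbTE ->; rewrite mul0r.
Qed.

Lemma monom0 : 'q^0 = 1.
Proof. by []. Qed.

Lemma monomD i j : 'q^(i + j)%N = 'q^i * 'q^j.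
Proof.
apply: fpsP => n; rewrite coef_monomM /=.
case: leqP => [le_in | lt_ni]; first by rewrite -{1}(subnKC le_in) eqn_add2l.
by rewrite ltn_eqF // (leq_trans lt_ni) ?leq_addr.
Qed.

Lemma monomX i n : 'q^i ^+ n = 'q^(i * n)%N.
Proof. by elim: n => [|n IHn]; rewrite ?muln0 // exprS IHn mulnS monomD. Qed.

(** The congruence f = g modulo q^n. *)
Definition eqmodq n f g := forall i, (i < n)%N -> coef f i = coef g i.

Lemma eqmodqP f g : (forall n, eqmodq n.+1 f g) -> f = g.
Proof. by move=> eq_fg; apply: fpsP => n; apply: (eq_fg n). Qed.

Lemma eqmodq_refl n f : eqmodq n f f.
Proof. by []. Qed.

Lemma eqmodq_sym n f g : eqmodq n f g -> eqmodq n g f.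
Proof. by move=> fg i /fg. Qed.

Lemma eqmodq_trans n g f h : eqmodq n f g -> eqmodq n g h -> eqmodq n f h.
Proof. by move=> fg gh i lt_in; rewrite fg ?gh. Qed.

Lemma eqmodqD n f f' g g' :
  eqmodq n f f' -> eqmodq n g g' -> eqmodq n (f + g) (f' + g').
Proof. by move=> eqf eqg i lt_in; rewrite !fps_coefD eqf ?eqg. Qed.

Lemma eqmodqM n f f' g g' :
  eqmodq n f f' -> eqmodq n g g' -> eqmodq n (f * g) (f' * g').
Proof.
move=> eqf eqg i lt_in; rewrite !fps_coefM; apply: eq_bigr => j _.
rewrite eqf ?eqg ?(leq_ltn_trans (leq_subr _ _)) //.
by apply: leq_trans lt_in; rewrite ltnS -ltnS.
Qed.

Lemma eqmodq_monomM n k f : (n <= k)%N -> eqmodq n ('q^k * f) 0.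
Proof. by move=> le_nk i lt_in; rewrite coef_monomM leqNgt (leq_trans lt_in). Qed.

End PowerSeriesRing.

Arguments monom {R} k.
Notation "''q^' k" := (monom k%N) (at level 3, k at level 2, format "''q^' k").

(** * Infinite products *)

Section InfiniteProducts.

Local Open Scope ring_scope.

Variable R : comNzRingType.
Implicit Types (f g : fps R) (F G : nat -> fps R).

(** The product of the F i over i >= 1; only the first n factors matter in
    degree n as soon as F i is 1 modulo q^i. *)
Definition iprod F : fps R :=
  Fps (fun n => coef (\prod_(i < n) F i.+1) n).

Definition admissible F := forall i, eqmodq i (F i) 1.

Lemma iprodE F n N :
  admissible F -> (n <= N)%N -> eqmodq n.+1 (iprod F) (\prod_(i < N) F i.+1).
Proof.
move=> F1 le_nN i le_in; have {le_in le_nN} := leq_trans (le_in : (i <= n)%N) le_nN.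
elim: N => [|N IHN]; first by rewrite leqn0 => /eqP ->.
rewrite leq_eqVlt => /predU1P[-> // | le_iN].
have eq1 : eqmodq i.+1 (F N.+1) 1.
  by move=> j lt_ji; rewrite (F1 N.+1) // (leq_trans lt_ji).
have /(_ i (ltnSn i)) := eqmodqM (@eqmodq_refl _ _ (\prod_(j < N) F j.+1)) eq1.
by rewrite big_ord_recr mulr1 IHN.
Qed.

Lemma iprodM F G : admissible F -> admissible G ->
  iprod (fun i => F i * G i) = iprod F * iprod G.
Proof.
move=> F1 G1; apply: eqmodqP => n.
have FG1 : admissible (fun i => F i * G i).
  by move=> i j lt_ji; rewrite (eqmodqM (F1 i) (G1 i)) // mulr1.
apply: eqmodq_trans (iprodE FG1 (leqnn n)) _; rewrite big_split /=.
by apply: eqmodqM; apply/eqmodq_sym/iprodE.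
Qed.

Lemma coef0_iprod F : coef (iprod F) 0 = 1.
Proof. by rewrite /= big_ord0. Qed.

Lemma admissible_1D i (c : fps R) : eqmodq i (1 + 'q^i * c) 1.
Proof.
by rewrite -[X in eqmodq _ _ X]addr0; apply: eqmodqD => //; apply: eqmodq_monomM.
Qed.

End InfiniteProducts.

(** * Dilations and arithmetic progressions of exponents *)

Section Dissection.

Local Open Scope ring_scope.

Variable R : comNzRingType.
Implicit Types f g : fps R.

(** The series f(q^k). *)
Definition dilate k f : fps R :=
  Fps (fun n => if (k %| n)%N then coef f (n %/ k) else 0).

(** For r = 0 this is the operator U_k of the theory of modular forms. *)
Definition extract k r f : fps R := Fps (fun n => coef f (k * n + r)).

Lemma extractD k r f g : extract k r (f + g) = extract k r f + extract k r g.
Proof. exact: fpsP. Qed.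

Lemma extractN k r f : extract k r (- f) = - extract k r f.
Proof. exact: fpsP. Qed.

Lemma extractMn k r f n : extract k r (f *+ n) = extract k r f *+ n.
Proof. by apply: fpsP => i; rewrite fps_coefMn /= fps_coefMn. Qed.

Lemma extract_monom k r j : (r < k)%N ->
  extract k r 'q^j = if (j %% k == r)%N then 'q^(j %/ k) else 0 :> fps R.
Proof.
move=> lt_rk; have k_gt0 := leq_ltn_trans (leq0n r) lt_rk; apply: fpsP => n /=.
have -> : (k * n + r == j)%N = (j %% k == r)%N && (n == j %/ k)%N.
  apply/eqP/andP => [<- | [/eqP <- /eqP ->]]; last by rewrite mulnC -divn_eq.
  by rewrite mulnC modnMDl divnMDl // divn_small // modn_small // addn0.
by case: ifP.
Qed.

Lemma sum_multiples k r n (F : nat -> R) : (r < k)%N ->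
  \sum_(i < (k * n + r).+1 | (k %| i)%N) F i = \sum_(j < n.+1) F (k * j)%N.
Proof.
move=> lt_rk; have k_gt0 := leq_ltn_trans (leq0n r) lt_rk.
have lt_h (j : 'I_n.+1) : (k * j < (k * n + r).+1)%N.
  rewrite ltnS (leq_trans _ (leq_addr r _)) // leq_mul2l -(ltnS j).
  by rewrite ltn_ord orbT.
rewrite (reindex_onto (fun j => Ordinal (lt_h j))
           (fun i : 'I_(k * n + r).+1 => inord (i %/ k))) /=; last first.
  move=> i /dvdnP[c ic]; apply/val_inj; rewrite /= ic mulnK //.
  have lt_cn : (c < n.+1)%N.
    rewrite -(ltn_pmul2l k_gt0) mulnC -ic (leq_trans (ltn_ord i)) // mulnS.
    by rewrite addnC ltn_add2r.
  by rewrite inordK // mulnC.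
apply: eq_bigl => j; rewrite dvdn_mulr //=; apply/eqP/val_inj => /=.
by rewrite mulKn // inordK.
Qed.

(** Extraction commutes with multiplication by a series in q^k; this is what
    makes dissections of quotients of products computable. *)
Lemma extractM k r f g : (r < k)%N ->
  extract k r (f * dilate k g) = extract k r f * g.
Proof.
move=> lt_rk; have k_gt0 := leq_ltn_trans (leq0n r) lt_rk.
rewrite mulrC [RHS]mulrC; apply: fpsP => n.
rewrite -[LHS]/(coef (dilate k g * f) (k * n + r)) !fps_coefM /=.
pose F i := coef g (i %/ k) * coef f (k * n + r - i)%N.
rewrite (eq_bigr (fun i : 'I_ _ => if (k %| i)%N then F i else 0)); last first.
  by move=> i _; case: ifP => //; rewrite mul0r.
rewrite -big_mkcond (@sum_multiples k r n F lt_rk); apply: eq_bigr => j _.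
rewrite /F mulKn // mulnBr addnBAC // leq_mul2l -(ltnS j).
by rewrite ltn_ord orbT.
Qed.

Lemma extract_dilate k r f : (r < k)%N ->
  extract k r (dilate k f) = if r == 0%N then f else 0.
Proof.
move=> lt_rk; rewrite -[dilate k f]mul1r extractM // -monom0 extract_monom //.
by rewrite mod0n div0n eq_sym; case: ifP; rewrite ?mul1r ?mul0r.
Qed.

Lemma extractP k f g : (0 < k)%N ->
  (forall r, (r < k)%N -> extract k r f = extract k r g) -> f = g.
Proof.
move=> k_gt0 eq_fg; apply: fpsP => n; rewrite (divn_eq n k) mulnC.
exact: (congr1 (fun h => coef h (n %/ k)) (eq_fg (n %% k)%N (ltn_pmod n k_gt0))).
Qed.

Lemma dilateM k f g : (0 < k)%N -> dilate k (f * g) = dilate k f * dilate k g.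
Proof.
move=> k_gt0; apply: (extractP k_gt0) => r lt_rk.
by rewrite extractM // !extract_dilate //; case: ifP => // _; rewrite mul0r.
Qed.

Lemma dilateD k f g : dilate k (f + g) = dilate k f + dilate k g.
Proof. by apply: fpsP => n /=; case: ifP; rewrite ?addr0. Qed.

Lemma dilateN k f : dilate k (- f) = - dilate k f.
Proof. by apply: fpsP => n /=; case: ifP; rewrite ?oppr0. Qed.

Lemma dilate_monom k j : (0 < k)%N -> dilate k 'q^j = 'q^(k * j) :> fps R.
Proof.
move=> k_gt0; apply: fpsP => n /=; case: ifP => [/dvdnP[c ->] | /negbT k'n].
  by rewrite mulnK // mulnC eqn_pmul2l.
by case: eqP k'n => // ->; rewrite dvdn_mulr.
Qed.

Lemma dilate1 k : (0 < k)%N -> dilate k 1 = 1 :> fps R.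
Proof. by move=> /(@dilate_monom k 0); rewrite muln0. Qed.

Lemma dilate_prod k I (r : seq I) (F : I -> fps R) : (0 < k)%N ->
  dilate k (\prod_(i <- r) F i) = \prod_(i <- r) dilate k (F i).
Proof.
move=> k_gt0; elim: r => [|i r IHr]; first by rewrite !big_nil dilate1.
by rewrite !big_cons dilateM // IHr.
Qed.

Lemma dilateX k f n : (0 < k)%N -> dilate k (f ^+ n) = dilate k f ^+ n.
Proof.
move=> k_gt0; elim: n => [|n IHn]; first exact: dilate1.
by rewrite !exprS dilateM // IHn.
Qed.

Lemma dilate_dilate j k f : (0 < j)%N ->
  dilate j (dilate k f) = dilate (j * k) f.
Proof.
move=> j_gt0; apply: fpsP => n /=; have [/dvdnP[c ->] | j'n] := boolP (j %| n)%N.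
  by rewrite mulnK // (mulnC j) dvdn_pmul2r // divnMr.
by case: ifP => // /(dvdn_trans (dvdn_mulr k (dvdnn j))); rewrite (negbTE j'n).
Qed.

Lemma eqmodq_dilate k n f g : (0 < k)%N ->
  eqmodq n f g -> eqmodq n (dilate k f) (dilate k g).
Proof.
move=> k_gt0 eq_fg i lt_in /=; rewrite eq_fg //.
exact: leq_ltn_trans (leq_div i k) lt_in.
Qed.

Lemma dissect3 f : f = dilate 3 (extract 3 0 f)
  + 'q^1 * dilate 3 (extract 3 1 f) + 'q^2 * dilate 3 (extract 3 2 f).
Proof.
apply: (@extractP 3) => // r lt_r3; rewrite !extractD !extractM //.
rewrite extract_dilate // !extract_monom //.
by case: r lt_r3 => [|[|[|]]] //= _; rewrite ?mul0r ?mul1r ?add0r ?addr0.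
Qed.

Lemma extract_sqr3 f r : (r < 3)%N ->
  let f_ i := extract 3 i f in
  extract 3 r (f ^+ 2) =
    if r == 0%N then f_ 0%N ^+ 2 + 'q^1 * f_ 1%N * f_ 2%N *+ 2 else
    if r == 1%N then f_ 0%N * f_ 1%N *+ 2 + 'q^1 * f_ 2%N ^+ 2 else
    f_ 1%N ^+ 2 + f_ 0%N * f_ 2%N *+ 2.
Proof.
move=> lt_r3 f_; rewrite [in LHS](dissect3 f) -!/(f_ _).
set a := f_ 0%N; set b := f_ 1%N; set c := f_ 2%N.
have -> : (dilate 3 a + 'q^1 * dilate 3 b + 'q^2 * dilate 3 c) ^+ 2
  = 'q^0 * dilate 3 a * dilate 3 a + 'q^1 * dilate 3 a * dilate 3 b *+ 2
    + 'q^2 * dilate 3 b * dilate 3 b + 'q^2 * dilate 3 a * dilate 3 c *+ 2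
    + 'q^3 * dilate 3 b * dilate 3 c *+ 2
    + 'q^4 * dilate 3 c * dilate 3 c.
  rewrite (monomD _ 1 1) (monomD _ 1 2) (monomD _ 2 2) (monomD _ 1 1) monom0.
  by ring.
rewrite !(extractD, extractMn, extractM) // !extract_monom //.
by case: r lt_r3 => [|[|[|]]] //= _; rewrite ?monom0; ring.
Qed.

(** In characteristic 3 cubing is q -> q^3 composed with the Frobenius map of
    the coefficients, hence plain dilation when these are fixed by it, as for
    the factors of the products considered here. *)
Lemma cube_iprod (F : nat -> fps R) : admissible F ->
  (forall i, F i ^+ 3 = dilate 3 (F i)) -> iprod F ^+ 3 = dilate 3 (iprod F).
Proof.
move=> F1 F3; apply: eqmodqP => n; have eqF := iprodE F1 (leqnn n).
apply: (@eqmodq_trans _ _ (\prod_(i < n) F i.+1 ^+ 3)).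
  rewrite prodrXl !exprS expr0; do 3!apply: eqmodqM => //.
apply: eqmodq_sym; apply: eqmodq_trans (eqmodq_dilate _ eqF) _ => //.
rewrite dilate_prod //; under eq_bigr do rewrite -F3.
exact: eqmodq_refl.
Qed.

End Dissection.

(** * Partial sums of the theta series *)

Section PartialSums.

Local Open Scope ring_scope.

(** The telescoping behind the q-binomial theorem: when c_s is the ratio
    (a;b)_s / (b;b)_s, the partial sums of the series in x satisfy its
    functional equation F(bx) (1 - ax) = F(x) (1 - x) up to one boundary term. *)
Lemma qbinomial_telescope (S : comNzRingType) (a b x : S) (c : nat -> S) N :
    (forall s, c s.+1 * (1 - b ^+ s.+1) = c s * (1 - a * b ^+ s)) ->
  (1 - a * x) * (\sum_(s < N.+1) c s * (b * x) ^+ s) =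
  (1 - x) * (\sum_(s < N.+1) c s * x ^+ s) + c N * (1 - a * b ^+ N) * x ^+ N.+1.
Proof.
move=> cS; elim: N => [|N IHN].
  by rewrite !big_ord_recl !big_ord0 !expr0 expr1; ring.
rewrite big_ord_recr [in RHS]big_ord_recr /= !mulrDr IHN -cS exprMn.
by rewrite [x ^+ N.+2]exprS; ring.
Qed.

(** In the two lemmas of this section every term of the sum over s, except the
    one for s = 0, is divisible by a power of q that grows with n.  In the limit
    the left-hand theta sum therefore becomes the quotient of the two products.
    Both are instances of the telescoping above, with (a, b, x) equal to
    (-1, q, -q^(n+1)) and (q, q^2, q^(2n+1)).  The ratios c s appear as an
    abstract sequence, so that no division is needed in S. *)

Section GaussPartialSums.

Variables (S : comNzRingType) (q : S) (c : nat -> S).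
Hypothesis c0 : c 0%N = 1.

Lemma gauss_square_partial n :
    (forall s, c s.+1 * (1 - q ^+ s.+1) = c s * (1 + q ^+ s)) ->
  (1 + \sum_(k < n) (-1) ^+ k.+1 * q ^+ (k.+1 ^ 2) *+ 2)
     * \prod_(i < n) (1 + q ^+ i.+1)
  = (\prod_(i < n) (1 - q ^+ i.+1)) * \sum_(s < n.+1) c s * (- q ^+ n.+1) ^+ s.
Proof.
move=> cS.
(* The factor 1 + q^0 in the numerator of c accounts for the 2. *)
have cB m : (\prod_(i < m.+1) (1 - q ^+ i.+1)) * c m.+1
    = (\prod_(i < m) (1 + q ^+ i.+1)) *+ 2.
  elim: m => [|m IHm].
    by rewrite big_ord_recl !big_ord0 mulr1 mulrC cS c0 mul1r.
  rewrite big_ord_recr [in RHS]big_ord_recr /= -mulrA [_ * c _]mulrC cS mulrA.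
  by rewrite IHm mulrnAl.
have cS' s : c s.+1 * (1 - q ^+ s.+1) = c s * (1 - -1 * q ^+ s).
  by rewrite cS mulN1r opprK.
elim: n => [|n IHn]; first by rewrite big_ord_recl !big_ord0 c0 expr0 !addr0 !mulr1.
have := qbinomial_telescope (- q ^+ n.+1) n cS'.
rewrite -cS' !mulN1r !opprK mulrN -exprS => tele.
rewrite big_ord_recr [in X in _ * X = _]big_ord_recr [RHS]mulrC.
rewrite [in RHS]big_ord_recr /=.
have -> : (-1) ^+ n.+1 * q ^+ (n.+1 ^ 2) = (- q ^+ n.+1) ^+ n.+1.
  by rewrite [RHS]exprNn -exprM mulnn.
have := cB n; rewrite big_ord_recr /=; move: IHn tele.
have -> : (- q ^+ n.+2) ^+ n.+1 = q ^+ n.+1 * (- q ^+ n.+1) ^+ n.+1.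
  by rewrite [in LHS](exprS q n.+1) -mulrN exprMn.
set T : S := \sum_(k < n) _.
set A : S := \prod_(i < n) _; set B : S := \prod_(i < n) _.
set S0 := \sum_(s < n.+1) _; set S1 := \sum_(s < n.+1) _.
set Z := (- _) ^+ n.+1; set y := q ^+ n.+1.
clearbody T A B S0 S1 Z y => IHn tele BC.
transitivity ((1 + T) * A * (1 + y) + A *+ 2 * Z * (1 + y)); first by ring.
transitivity (B * ((1 - y) * S1) + B * (1 - y) * c n.+1 * (y * Z)).
  by rewrite tele BC IHn -BC; ring.
by rewrite -/y; ring.
Qed.

Lemma gauss_triangular_partial n :
    (forall s, c s.+1 * (1 - q ^+ (2 * s.+1)) = c s * (1 - q ^+ (2 * s).+1)) ->
  (\sum_(j < 2 * n) q ^+ 'C(j.+1, 2)) * \prod_(i < n) (1 - q ^+ (2 * i).+1)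
  = (\prod_(i < n) (1 - q ^+ (2 * i.+1)))
      * \sum_(s < n) c s * (q ^+ (2 * n).+1) ^+ s.
Proof.
move=> cS.
have cB m : (\prod_(i < m) (1 - q ^+ (2 * i.+1))) * c m
    = \prod_(i < m) (1 - q ^+ (2 * i).+1).
  elim: m => [|m IHm]; first by rewrite !big_ord0 c0 mulr1.
  by rewrite !big_ord_recr /= -IHm -!mulrA -cS [c m.+1 * _]mulrC.
have cS' s : c s.+1 * (1 - (q ^+ 2) ^+ s.+1) = c s * (1 - q * (q ^+ 2) ^+ s).
  by rewrite -!exprM -exprS.
elim: n => [|n IHn]; first by rewrite !big_ord0 mul0r mulr0.
have := qbinomial_telescope (q ^+ (2 * n).+1) n cS'.
rewrite -exprM -!exprS -exprD.
have -> : (2 + (2 * n).+1 = (2 * n.+1).+1)%N by rewrite mulnS.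
have -> : ((2 * n).+2 = 2 * n.+1)%N by rewrite mulnS.
rewrite [in X in _ = X + _]big_ord_recr /= => tele.
rewrite [in X in _ * X = _]big_ord_recr [in X in _ = X * _]big_ord_recr /=.
have -> : \sum_(j < 2 * n.+1) q ^+ 'C(j.+1, 2) =
    \sum_(j < 2 * n) q ^+ 'C(j.+1, 2) + (q ^+ (2 * n).+1) ^+ n
      + (q ^+ (2 * n).+1) ^+ n.+1.
  have tri0 : 'C((2 * n).+1, 2) = ((2 * n).+1 * n)%N.
    by rewrite bin2odd /= mul2n ?odd_double // doubleK.
  rewrite mulnS add2n !big_ord_recr /= -!exprM -tri0.
  by rewrite [in 'C(_.+2, 2)]binS bin1 mulnS -tri0 [in RHS]addnC.
move: IHn (cB n) tele.
set T : S := \sum_(j < 2 * n) _; set A : S := \prod_(i < n) _.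
set B : S := \prod_(i < n) _; set S0 : S := \sum_(s < n) _.
set S1 : S := \sum_(s < n.+1) _; rewrite [_ ^+ n.+1]exprS.
set Z := _ ^+ n; set y := q ^+ (2 * n).+1; set w := q ^+ _.
clearbody T A B S0 S1 Z y w => IHn BC tele.
transitivity (T * A * (1 - y) + A * (1 - y) * (Z + y * Z)); first by ring.
transitivity (B * ((1 - w) * S1)); last by ring.
by rewrite tele IHn -BC; ring.
Qed.

End GaussPartialSums.

End PartialSums.

(** * Theta series of Gauss *)

Section ThetaSeries.

Local Open Scope ring_scope.

Variable R : comNzRingType.

(** The series with terms c k * q^(e k); the sum defining the coefficient of
    degree n is complete when k <= e k. *)
Definition sparse (e : nat -> nat) (c : nat -> R) : fps R :=
  Fps (fun n => \sum_(k < n.+1 | e k == n) c k).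

Lemma sparseE e c n : (forall k, (k <= e k)%N) ->
  eqmodq n (sparse e c) (\sum_(k < n) Fps (fun i => c k * (i == e k)%:R)).
Proof.
move=> le_e i lt_in; rewrite fps_coef_sum /=.
rewrite (big_ord_widen_cond n (fun k => e k == i) c) //.
rewrite big_mkcond /=; apply: eq_bigr => k _; rewrite (eq_sym i).
case: eqP => [<- | _] /=; last by rewrite mulr0.
by rewrite ltnS le_e mulr1.
Qed.

Lemma coef_sparse e c k : injective e -> (forall j, (j <= e j)%N) ->
  coef (sparse e c) (e k) = c k.
Proof.
move=> inj_e le_e /=; have lt_k : (k < (e k).+1)%N by rewrite ltnS.
rewrite (bigD1 (Ordinal lt_k)) //= big1 ?addr0 // => j /andP[/eqP/inj_e jk].
by rewrite -val_eqE /= jk eqxx.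
Qed.

Lemma coef_sparse_eq0 e c n : (forall k, e k != n) -> coef (sparse e c) n = 0.
Proof. by move=> en; rewrite /= big1 // => k; rewrite (negbTE (en k)). Qed.

(** The sum over all integers k of (-1)^k q^(k^2), with k and -k grouped. *)
Definition phi := sparse (fun k => k ^ 2)%N
  (fun k => if k == 0%N then 1 else (-1) ^+ k *+ 2).
Definition psi := sparse (fun k => 'C(k.+1, 2)) (fun=> 1).

Definition prod1B : fps R := iprod (fun i => 1 - 'q^i).
Definition prod1D : fps R := iprod (fun i => 1 + 'q^i).
Local Notation D := prod1B.
Local Notation P := prod1D.

(** The inverse of 1 - q^d is the sum of the powers of q^d. *)
Lemma inv_1BX k : {g : fps R | (1 - 'q^k.+1) * g = 1}.
Proof.
exists (dilate k.+1 (Fps (fun=> 1))); apply: fpsP => n.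
rewrite mulrBl mul1r fps_coefD fps_coefN coef_monomM /=.
have [le_kn | lt_nk] := leqP k.+1 n.
  rewrite dvdn_subl // subrr; case: n le_kn => //.
by rewrite subr0; case: n lt_nk => //= n lt_nk; rewrite gtnNdvd.
Qed.

(** Provides the ratios c required by the two finite identities. *)
Lemma qratio_exists (u : nat -> fps R) d : (0 < d)%N ->
  {c : nat -> fps R | c 0%N = 1
    & forall s, c s.+1 * (1 - 'q^(d * s.+1)) = c s * u s}.
Proof.
move=> d_gt0.
pose inv s := sval (inv_1BX (d * s.+1).-1).
exists (fun s => \prod_(i < s) (u i * inv i)); first by rewrite big_ord0.
move=> s; rewrite big_ord_recr /= -!mulrA mulrC [inv s * _]mulrC.
have -> : (1 - 'q^(d * s.+1)) * inv s = 1; last by rewrite mulr1 mulrC.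
by rewrite /inv; case: inv_1BX => g; rewrite prednK ?muln_gt0 ?d_gt0.
Qed.

Lemma eqmodq_le m n (f g : fps R) : (m <= n)%N -> eqmodq n f g -> eqmodq m f g.
Proof. by move=> le_mn eq_fg i lt_im; apply/eq_fg/leq_trans/le_mn. Qed.

Lemma eqmodq_sum_powers (c : nat -> fps R) (x : fps R) n m : c 0%N = 1 ->
  eqmodq n (\sum_(s < m.+1) c s * ('q^n * x) ^+ s) 1.
Proof.
move=> c0 i lt_in; rewrite big_ord_recl c0 expr0 mulr1 fps_coefD.
rewrite fps_coef_sum big1 ?addr0 // => s _.
by rewrite exprS mulrCA -mulrA; apply: eqmodq_monomM lt_in.
Qed.

Lemma admissible_1B_monom : admissible (fun i => 1 - 'q^i : fps R).
Proof. by move=> i; rewrite -[- _]mulr1 mulNr -mulrN; apply: admissible_1D. Qed.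

Lemma admissible_1D_monom : admissible (fun i => 1 + 'q^i : fps R).
Proof. by move=> i; rewrite -['q^i]mulr1; apply: admissible_1D. Qed.

Lemma coef0_prod1B : coef D 0 = 1.
Proof. exact: coef0_iprod. Qed.

Lemma coef0_prod1D : coef P 0 = 1.
Proof. exact: coef0_iprod. Qed.

Lemma monomE k : 'q^k = 'q^1 ^+ k :> fps R.
Proof. by rewrite monomX mul1n. Qed.

Lemma coef_signM k (f : fps R) n : coef ((-1) ^+ k * f) n = (-1) ^+ k * coef f n.
Proof.
by rewrite -!(signr_odd _ k); case: odd; rewrite ?mulN1r ?fps_coefN ?mul1r.
Qed.

Lemma phi_partial n :
  eqmodq n.+1 phi (1 + \sum_(k < n) (-1) ^+ k.+1 * 'q^1 ^+ (k.+1 ^ 2) *+ 2).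
Proof.
apply: eqmodq_trans (sparseE _ _) _ => [k | ].
  by rewrite -mulnn; case: k => // k; rewrite leq_pmulr.
rewrite big_ord_recl; apply: eqmodqD => [i _ | ]; first by rewrite /= mul1r.
move=> i _; rewrite !fps_coef_sum; apply: eq_bigr => k _.
by rewrite fps_coefMn coef_signM -monomE lift0 /= mulrnAl.
Qed.

Lemma psi_partial n :
  eqmodq n psi (\sum_(k < n) 'q^1 ^+ 'C(k.+1, 2)).
Proof.
apply: eqmodq_trans (sparseE _ _) _ => [k | i _].
  by rewrite binS bin1 leq_addl.
by rewrite !fps_coef_sum; apply: eq_bigr => k _; rewrite -monomE /= mul1r.
Qed.

Lemma phi_eq_prod : phi * P = D.
Proof.
have [c c0 cS] := @qratio_exists (fun s => 1 + 'q^1 ^+ s) 1 isT.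
have {}cS s : c s.+1 * (1 - 'q^1 ^+ s.+1) = c s * (1 + 'q^1 ^+ s).
  by rewrite -cS mul1n -monomE.
apply: eqmodqP => n.
have PE : eqmodq n.+1 P (\prod_(i < n) (1 + 'q^1 ^+ i.+1)).
  by under eq_bigr do rewrite -monomE; apply: iprodE admissible_1D_monom (leqnn n).
have DE : eqmodq n.+1 D (\prod_(i < n) (1 - 'q^1 ^+ i.+1)).
  by under eq_bigr do rewrite -monomE; apply: iprodE admissible_1B_monom (leqnn n).
apply: eqmodq_trans (eqmodqM (@phi_partial n) PE) _.
rewrite (gauss_square_partial c0 n cS).
rewrite -[X in eqmodq _ _ X]mulr1; apply: eqmodqM.
  exact: eqmodq_sym.
by rewrite -monomE -[- _]mulr1 mulNr -mulrN; apply: eqmodq_sum_powers.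
Qed.

(** The finite identity has the odd factors 1 - q^(2i+1) on the left.  They are
    completed to D by the even ones, each of which factors as
    1 - q^(2i) = (1 - q^i) (1 + q^i). *)
Lemma psi_eq_prod : psi = D * P ^+ 2.
Proof.
apply: (mul_fps_inj coef0_prod1B).
have [c c0 cS] := @qratio_exists (fun s => 1 - 'q^1 ^+ (2 * s).+1) 2 isT.
have {}cS s :
    c s.+1 * (1 - 'q^1 ^+ (2 * s.+1)) = c s * (1 - 'q^1 ^+ (2 * s).+1).
  by rewrite -cS -monomE.
apply: eqmodqP => n; rewrite -[X in eqmodq _ X _]mulrC.
(* With n itself the sum over s < n could be empty and miss the term s = 0. *)
pose m := n.+1; have le_n2m : (n <= 2 * m)%N by rewrite /m; lia.
have PE := iprodE admissible_1D_monom (leqnSn n).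
have DE := iprodE admissible_1B_monom (leqnSn n).
have DE2 := iprodE admissible_1B_monom le_n2m.
have psiE : eqmodq n.+1 psi (\sum_(k < 2 * m) 'q^1 ^+ 'C(k.+1, 2)).
  by apply: eqmodq_le (@psi_partial (2 * m)); rewrite leq_pmull.
apply: eqmodq_trans (eqmodqM psiE DE2) _.
rewrite (_ : D * (D * P ^+ 2) = D * P * 1 * D * P); last by ring.
have split_D k : \prod_(i < 2 * k) (1 - 'q^i.+1) =
    (\prod_(i < k) (1 - 'q^1 ^+ (2 * i).+1)) *
    ((\prod_(i < k) (1 - 'q^i.+1)) * \prod_(i < k) (1 + 'q^i.+1)) :> fps R.
  elim: k => [|k IHk]; first by rewrite muln0 !big_ord0 !mulr1.
  rewrite mulnS add2n !big_ord_recr /= IHk -monomE.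
  have -> : 'q^(2 * k).+2 = 'q^k.+1 * 'q^k.+1 :> fps R.
    by rewrite -monomD addnn -mul2n mulnS.
  by ring.
rewrite split_D !mulrA (gauss_triangular_partial c0 m cS).
have -> : \prod_(i < m) (1 - 'q^1 ^+ (2 * i.+1)) =
    (\prod_(i < m) (1 - 'q^i.+1)) * \prod_(i < m) (1 + 'q^i.+1) :> fps R.
  rewrite -big_split; apply: eq_bigr => i _.
  by rewrite mul2n -addnn -monomE monomD /=; ring.
do 2![apply: eqmodqM; last exact: eqmodq_sym].
apply: eqmodqM; first by apply: eqmodqM; apply: eqmodq_sym.
have -> : 'q^1 ^+ (2 * m).+1 = 'q^n.+1 * 'q^(n + 2) :> fps R.
  by rewrite -monomE -monomD; congr monom; rewrite /m; lia.
by apply: eqmodq_sum_powers.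
Qed.

End ThetaSeries.

(** * The generating function of A m *)

Section Counting.

Implicit Types (s t : seq (nat * bool)) (p : pred (seq (nat * bool))).

(** Removing the largest part: it may be followed by copies of itself only if
    these are not overlined. *)
Lemma overpartition_cons n i b t :
  is_overpartition n ((i, b) :: t) =
  [&& 0 < i, i <= n, all (fun x => x.1 <= i) t, (i, true) \notin t
    & is_overpartition (n - i) t].
Proof.
rewrite /is_overpartition /= path_sortedE; last exact: rev_trans leq_trans.
have -> : (i + sumn (unzip1 t) == n) = (i <= n) && (sumn (unzip1 t) == n - i).
  case: leqP => [le_in | lt_ni]; first by rewrite -[RHS](eqn_add2l i) subnKC.
  by rewrite gtn_eqF // (leq_trans lt_ni) ?leq_addr.
have -> : all (geq i) (unzip1 t) = all (fun x => x.1 <= i) t by rewrite all_map.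
have -> : all [pred y : nat * bool | y.2 ==> (i != y.1)] t = ((i, true) \notin t).
  rewrite -has_pred1 -all_predC; apply: eq_all => -[j c] /=.
  rewrite xpair_eqE eqb_id andbC negb_and implybE.
  by case: c; rewrite ?orbF //= eq_sym.
move: (sumn _ == _) (sorted _ _) (pairwise _ _) (all (leq 1) _) => sm so pw po.
move: (all _ t) (_ \notin _) (0 < i) (i <= n).
by do 4!case; rewrite /= ?andbF //; case: po; rewrite //= andbF.
Qed.

(** The overpartitions of n satisfying p, as the images of the finite type on
    which A is defined; the recurrences below compare such enumerations. *)
Definition overpartitions p n : seq (seq (nat * bool)) :=
  [seq s <- [seq parts_of u | u <- enum {: n.-bseq ('I_n.+1 * bool)}]
     | is_overpartition n s && p s].

Lemma mem_overpartitions p n s :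
  (s \in overpartitions p n) = is_overpartition n s && p s.
Proof.
rewrite mem_filter andb_idr // => /andP[/overpartition_parts_of[t <-] _].
by rewrite map_f ?mem_enum.
Qed.

Lemma overpartitions_uniq p n : uniq (overpartitions p n).
Proof.
by rewrite filter_uniq // map_inj_uniq ?enum_uniq //; apply: parts_of_inj.
Qed.

Definition count_op p n := size (overpartitions p n).

Lemma A_count m n : A m n = count_op (overlined_nondvd m) n.
Proof.
rewrite /A cardsE /count_op size_filter count_map cardE size_filter.
by rewrite enumT; apply: eq_count.
Qed.

Lemma count_op_eq p n (l : seq (seq (nat * bool))) :
  uniq l -> (forall s, (s \in l) = is_overpartition n s && p s) ->
  count_op p n = size l.
Proof.
move=> l_uniq mem_l; apply/perm_size/uniq_perm => // [|s].
  exact: overpartitions_uniq.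
by rewrite mem_l mem_overpartitions.
Qed.

Variable m : nat.

(** The overpartitions counted by A m with all parts at most k, and among them
    those in which k itself is not overlined.  The second family is needed since
    the parts that follow a first part k are not overlined when equal to k. *)
Definition max_part k s := overlined_nondvd m s && all (fun x => x.1 <= k) s.

Definition max_part_plain k s := max_part k s && ((k, true) \notin s).

Lemma max_part_step n k s :
  is_overpartition n s && max_part k.+1 s =
  is_overpartition n s && max_part k s ||
  (if s is x :: t then
     [&& x.1 == k.+1, x.2 ==> ~~ (m %| k.+1), k < n,
         is_overpartition (n - k.+1) t & max_part_plain k.+1 t]
   else false).
Proof.
case: s => [|[i b] t]; first by rewrite orbF.
rewrite overpartition_cons /max_part_plain /max_part /overlined_nondvd /=.
have [-> | ne_ik] := eqVneq i k.+1.
  rewrite ltnn /= leqnn; move: (b ==> _) (_ \notin _) (is_overpartition _ _).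
  move: (all _ t) (all _ t) (k < n).
  by do 6!case; rewrite ?andbF.
rewrite orbF [i <= k.+1]leq_eqVlt (negbTE ne_ik) /= ltnS.
have [le_ik | _] := leqP i k; last by rewrite !andbF.
have le_all h : i <= h -> all (fun x => x.1 <= i) t -> all (fun x => x.1 <= h) t.
  by move=> le_ih; apply: sub_all => x /leq_trans; apply.
case all_i: (all _ t); last by rewrite !andbF.
by rewrite (le_all k) ?(le_all k.+1) ?andbT // ltnW.
Qed.

Lemma max_part_plain_step n k s :
  is_overpartition n s && max_part_plain k.+1 s =
  is_overpartition n s && max_part k s ||
  (if s is x :: t then
     [&& x == (k.+1, false), k < n, is_overpartition (n - k.+1) t
       & max_part_plain k.+1 t]
   else false).
Proof.
rewrite {1}/max_part_plain andbA max_part_step andb_orl; congr (_ || _).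
  rewrite /max_part; case k1: ((k.+1, true) \in s); rewrite ?andbT //= !andbF.
  by apply/esym/negbTE/negP => /and3P[_ _ /allP/(_ _ k1)]; rewrite /= ltnn.
case: s => [|[i b] t] //=; rewrite inE !xpair_eqE (eq_sym k.+1).
case: eqVneq => //= _; case: b; rewrite ?andbF //=.
by rewrite andb_idr // => /and3P[_ _ /andP[]].
Qed.

Lemma count_max_part0 n : count_op (max_part 0) n = (n == 0).
Proof.
have -> : (n == 0) = size (nseq (n == 0) ([::] : seq (nat * bool))) :> nat.
  by rewrite size_nseq.
apply: count_op_eq => [|[|[i b] t]]; first by case: n.
  by rewrite /is_overpartition eq_sym /=; case: n.
rewrite overpartition_cons /max_part /=; case: i => [|i]; first by case: n.
by rewrite !andbF; case: n.
Qed.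

Lemma notin_overpartitions_max_part n k t b :
  ((k.+1, b) :: t \in overpartitions (max_part k) n) = false.
Proof. by rewrite mem_overpartitions /max_part /= ltnn !andbF. Qed.

Lemma count_max_part n k :
  count_op (max_part k.+1) n = count_op (max_part k) n +
    (~~ (m %| k.+1)).+1 *
    (if k < n then count_op (max_part_plain k.+1) (n - k.+1) else 0).
Proof.
pose L b := if (b ==> ~~ (m %| k.+1)) && (k < n) then
  map (cons (k.+1, b)) (overpartitions (max_part_plain k.+1) (n - k.+1)) else [::].
have L_uniq b : uniq (L b).
  rewrite /L; case: ifP => // _; rewrite map_inj_uniq ?overpartitions_uniq //.
  by move=> s t [].
have mem_L b s : (s \in L b) = if s is x :: t then
    [&& x == (k.+1, b), b ==> ~~ (m %| k.+1), k < n
      & t \in overpartitions (max_part_plain k.+1) (n - k.+1)] else false.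
  rewrite /L; case: ifP => [/andP[-> ->] | kn]; last first.
    case: s => // x t; rewrite in_nil; move: kn.
    by case: (_ ==> _); case: (_ < _); rewrite ?andbF.
  case: s => [|x t] /=; first by apply/mapP => -[].
  apply/mapP/andP => [[u Lu [-> ->]] | [/eqP -> Lt]]; last by exists t.
  by rewrite eqxx Lu.
rewrite (@count_op_eq _ _ (overpartitions (max_part k) n ++ L false ++ L true)).
- rewrite !size_cat; congr (_ + _); rewrite /L /=.
  case: (k < n); case: (m %| k.+1) => //=.
  - by rewrite size_map addn0 mul1n.
  by rewrite !size_map mul2n addnn.
- rewrite !cat_uniq overpartitions_uniq !L_uniq has_cat /= andbT negb_or.
  have notin b : ~~ has (mem (overpartitions (max_part k) n)) (L b).
    apply/hasPn => -[|x t]; rewrite mem_L // => /and4P[/eqP -> _ _ _].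
    exact/negbT/notin_overpartitions_max_part.
  rewrite !notin /=; apply/hasPn => -[|x t]; rewrite mem_L //.
  case/and4P => /eqP -> _ _ _; rewrite -[X in ~~ X]/(_ \in L false).
  by rewrite mem_L xpair_eqE andbF.
move=> s; rewrite !mem_cat !mem_L mem_overpartitions max_part_step.
congr (_ || _); case: s => [|[i b] t] //; rewrite mem_overpartitions !xpair_eqE /=.
by case: (i == _); case: b; rewrite ?orbF.
Qed.

Lemma count_max_part_plain n k :
  count_op (max_part_plain k.+1) n = count_op (max_part k) n +
    (if k < n then count_op (max_part_plain k.+1) (n - k.+1) else 0).
Proof.
pose L := if k < n then
  map (cons (k.+1, false)) (overpartitions (max_part_plain k.+1) (n - k.+1))
  else [::].
have mem_L s : (s \in L) = if s is x :: t then
    [&& x == (k.+1, false), k < n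
      & t \in overpartitions (max_part_plain k.+1) (n - k.+1)] else false.
  rewrite /L; case: ifP => kn; last by case: s => // x t; rewrite andbF.
  case: s => [|x t] /=; first by apply/mapP => -[].
  apply/mapP/andP => [[u Lu [-> ->]] | [/eqP -> Lt]]; last by exists t.
  by rewrite eqxx Lu.
rewrite (@count_op_eq _ _ (overpartitions (max_part k) n ++ L)).
- by rewrite size_cat /L; case: ifP; rewrite ?size_map.
- rewrite cat_uniq overpartitions_uniq /=; apply/andP; split.
    apply/hasPn => -[|x t]; rewrite mem_L // => /and3P[/eqP -> _ _].
    exact/negbT/notin_overpartitions_max_part.
  rewrite /L; case: ifP => // _; rewrite map_inj_uniq ?overpartitions_uniq //.
  by move=> s t [].
move=> s; rewrite mem_cat mem_L mem_overpartitions max_part_plain_step.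
by congr (_ || _); case: s => // x t; rewrite mem_overpartitions.
Qed.

(** Parts of an overpartition of n are at most n. *)
Lemma A_max_part n k : n <= k -> A m n = count_op (max_part k) n.
Proof.
move=> le_nk; rewrite A_count; apply: count_op_eq => [|s].
  exact: overpartitions_uniq.
rewrite mem_overpartitions /max_part; case op_s: is_overpartition => //=.
rewrite andb_idr // => _; case/and4P: op_s => _ _ /eqP sum_s _.
apply/allP => x xs; apply: leq_trans le_nk; rewrite -sum_s.
by elim: s xs {sum_s} => //= y s IHs; rewrite inE => /predU1P[<- | /IHs]; lia.
Qed.

End Counting.

Section GeneratingFunction.

Local Open Scope ring_scope.

Variable R : comNzRingType.
Local Notation D := (prod1B R).
Local Notation P := (prod1D R).

Definition genA m : fps R := Fps (fun n => (A m n)%:R).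

Let bounded m k : fps R := Fps (fun n => (count_op (max_part m k) n)%:R).

(** If a_k and b_k enumerate the overpartitions with parts at most k, and those
    in which k is not overlined, then the removal of a first part k+1 gives
    b_(k+1) = a_k + q^(k+1) b_(k+1) and a_(k+1) = a_k + e q^(k+1) b_(k+1), where
    e is 2 when k+1 may be overlined and 1 otherwise; b_(k+1) is eliminated. *)
Lemma bounded_rec m k :
  bounded m k.+1 * (1 - 'q^k.+1) =
  bounded m k * (1 + 'q^k.+1 *+ ~~ (m %| k.+1)%N).
Proof.
pose plain : fps R := Fps (fun n => (count_op (max_part_plain m k.+1) n)%:R).
have plainE : plain = bounded m k + 'q^k.+1 * plain.
  apply: fpsP => n; rewrite fps_coefD coef_monomM /= count_max_part_plain natrD.
  by case: ifP.
have -> : bounded m k.+1 =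
    bounded m k + ('q^k.+1 * plain) *+ (~~ (m %| k.+1)%N).+1.
  apply: fpsP => n; rewrite fps_coefD fps_coefMn coef_monomM /=.
  by rewrite count_max_part natrD mulnC natrM mulr_natr; case: ifP.
have -> : bounded m k = plain * (1 - 'q^k.+1).
  by rewrite mulrBr mulr1 {1}plainE; ring.
by case: (m %| _)%N; rewrite /= ?mulr0n ?mulr1n; ring.
Qed.

Lemma bounded_prod m n :
  bounded m n * \prod_(i < n) (1 - 'q^i.+1)
  = \prod_(i < n) (1 + 'q^i.+1 *+ ~~ (m %| i.+1)%N).
Proof.
elim: n => [|n IHn].
  rewrite !big_ord0 mulr1; apply: fpsP => n /=.
  by rewrite count_max_part0.
by rewrite !big_ord_recr /= -IHn mulrCA bounded_rec; ring.
Qed.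

Lemma admissible_overlined m :
  admissible (fun i => 1 + 'q^i *+ ~~ (m %| i)%N : fps R).
Proof. by move=> i; rewrite -mulr_natr; apply: admissible_1D. Qed.

Lemma genA_iprod m :
  genA m * D = iprod (fun i => 1 + 'q^i *+ ~~ (m %| i)%N).
Proof.
apply: eqmodqP => n.
apply: eqmodq_trans (eqmodq_sym (iprodE (@admissible_overlined m) (leqnn n))).
rewrite -bounded_prod.
apply: eqmodqM; last exact: iprodE (@admissible_1B_monom R) _.
by move=> i lt_in; rewrite /= (A_max_part _ (lt_in : (i <= n)%N)).
Qed.

Let multiples m i : fps R := if (m %| i)%N then 1 + 'q^i else 1.

Lemma admissible_multiples m : admissible (multiples m).
Proof.
by move=> i; rewrite /multiples; case: ifP => // _; apply: admissible_1D_monom.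
Qed.

Lemma dilate_prod1D m : (0 < m)%N -> dilate m P = iprod (multiples m).
Proof.
move=> m_gt0; apply: eqmodqP => n.
have le_nmn : (n <= m * n)%N by rewrite leq_pmull.
apply: eqmodq_trans (eqmodq_sym (iprodE (@admissible_multiples m) le_nmn)).
have /(eqmodq_dilate m_gt0) := iprodE (@admissible_1D_monom R) (leqnn n).
move=> /eqmodq_trans; apply; rewrite dilate_prod //.
under eq_bigr do rewrite dilateD dilate1 // dilate_monom //.
suff -> : \prod_(i < m * n) multiples m i.+1 = \prod_(i < n) (1 + 'q^(m * i.+1)).
  exact: eqmodq_refl.
elim: n {le_nmn} => [|n IHn]; first by rewrite muln0 !big_ord0.
rewrite mulnSr big_split_ord big_ord_recr /= -IHn; congr (_ * _).
case: m m_gt0 {IHn} => // m _; rewrite big_ord_recr /= big1 => [|i _].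
  by rewrite mul1r /multiples -addnS -mulnSr dvdn_mulr.
rewrite /multiples -addnS dvdn_addr ?dvdn_mulr // gtnNdvd //.
by rewrite ltnS ltn_ord.
Qed.

(** The factors 1 + q^i with m | i, which are missing from the numerator of the
    generating function, are those of P(q^m). *)
Lemma genA_prod m : (0 < m)%N -> genA m * D * dilate m P = P.
Proof.
move=> m_gt0; rewrite genA_iprod dilate_prod1D //.
rewrite -iprodM; [| exact: admissible_overlined | exact: admissible_multiples].
congr iprod; apply: boolp.funext => i; rewrite /multiples.
by case: (m %| i)%N; rewrite ?addr0 ?mul1r ?mulr1.
Qed.

(** The square theta series inverts the generating function up to a factor that
    is a series in q^m. *)
Lemma genA_phi m : (0 < m)%N -> genA m * phi R * dilate m P = 1.
Proof.
move=> m_gt0; apply: (mul_fps_inj (@coef0_prod1D R)).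
rewrite mulr1 -[RHS](genA_prod m_gt0) -phi_eq_prod.
by ring.
Qed.

End GeneratingFunction.

(** * Sections of the theta series *)

Lemma sqr_mod3 j : (j ^ 2 %% 3 != 2) /\ (j ^ 2 %% 3 = 0 -> exists i, j = 3 * i + 0).
Proof.
rewrite -modnXm; split.
  by have := ltn_pmod j (isT : 0 < 3); case: (j %% 3) => [|[|[|]]].
have := divn_eq j 3; have := ltn_pmod j (isT : 0 < 3).
by case: (j %% 3) => [|[|[|]]] // _ -> _; exists (j %/ 3); rewrite mulnC.
Qed.

(** A sum of two squares divisible by 3 is divisible by 9. *)
Lemma sqr_add_mod9 i j : (i ^ 2 + j ^ 2) %% 9 != 6.
Proof.
have /allP ok : all (fun a => all (fun b => (a ^ 2 + b ^ 2) %% 9 != 6) (iota 0 9))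
  (iota 0 9) by [].
rewrite -modnDm -(modnXm 2 9 i) -(modnXm 2 9 j) modnDm.
have /ok/allP : i %% 9 \in iota 0 9 by rewrite mem_iota ltn_pmod.
by apply; rewrite mem_iota ltn_pmod.
Qed.

Lemma tri2 j : 2 * 'C(j.+1, 2) = j * j.+1.
Proof. by rewrite bin2 /= mul2n even_halfK 1?mulnC // oddM /= andbN. Qed.

Lemma triD3 j : 'C((3 * j + 1).+1, 2) = 3 * (3 * 'C(j.+1, 2)) + 1.
Proof. by have := tri2 j; have := tri2 (3 * j + 1); nia. Qed.

Lemma tri_mod3 j :
  ('C(j.+1, 2) %% 3 != 2) /\ ('C(j.+1, 2) %% 3 = 1 -> exists i, j = 3 * i + 1).
Proof.
have := tri2 j; have := divn_eq j 3; have := ltn_pmod j (isT : 0 < 3).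
case: (j %% 3) => [|[|[|]]] // _; set i := j %/ 3 => ->.
- by split=> [|]; [|exists 0]; nia.
- by rewrite (mulnC i) triD3; split=> [|_]; [lia | exists i].
- by split=> [|]; [|exists 0]; nia.
Qed.

Lemma tri_inj : injective (fun j => 'C(j.+1, 2)).
Proof. by move=> i j /= ij; have := tri2 i; have := tri2 j; nia. Qed.

Lemma leq_tri j : j <= 'C(j.+1, 2).
Proof. by rewrite binS bin1 leq_addl. Qed.

Lemma leq_sqr j : j <= j ^ 2.
Proof. by rewrite -mulnn; case: j => // j; rewrite leq_pmulr. Qed.

Lemma sqr_inj : injective (fun j => j ^ 2).
Proof. by move=> i j /eqP; rewrite eqn_exp2r // => /eqP. Qed.

Section SparseSections.

Local Open Scope ring_scope.

Variable R : comNzRingType.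
Local Notation phi := (phi R).
Local Notation psi := (psi R).

Lemma extract_sparse_eq0 k r e (c : nat -> R) :
  (r < k)%N -> (forall j, e j %% k != r)%N -> extract k r (sparse e c) = 0.
Proof.
move=> lt_rk er; apply: fpsP => n; rewrite [LHS]coef_sparse_eq0 // => j.
by apply: contra (er j) => /eqP->; rewrite mulnC modnMDl modn_small.
Qed.

Lemma extract_sparseM_eq0 k r e e' (c c' : nat -> R) :
    (r < k)%N -> (forall i j, (e i + e' j) %% k != r)%N ->
  extract k r (sparse e c * sparse e' c') = 0.
Proof.
move=> lt_rk er; apply: fpsP => n.
rewrite -[LHS]/(coef (sparse e c * sparse e' c') (k * n + r)) fps_coefM big1 //.
move=> i _ /=; rewrite big_distrl big1 //= => a /eqP ea.
rewrite big_distrr big1 //= => b /eqP eb; case/eqP: (er a b).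
rewrite ea eb subnKC; first by rewrite mulnC modnMDl modn_small.
by rewrite -ltnS.
Qed.

(** When the exponents that are r modulo k are the k^2 t + r with t an exponent,
    the series reproduces itself, up to dilation, on that class. *)
Lemma extract_sparse_self k r a e (c : nat -> R) :
    injective e -> (forall j, (j <= e j)%N) -> (r < k)%N ->
    (forall i, e (k * i + a) = k * (k * e i) + r)%N ->
    (forall i, c (k * i + a)%N = c i) ->
    (forall j, e j %% k = r -> exists i, j = k * i + a)%N ->
  extract k r (sparse e c) = dilate k (sparse e c).
Proof.
move=> inj_e le_e lt_rk ek ck er; apply: fpsP => n.
have k_gt0 := leq_ltn_trans (leq0n r) lt_rk.
rewrite -[LHS]/(coef (sparse e c) (k * n + r)).
rewrite -[RHS]/(if (k %| n)%N then coef (sparse e c) (n %/ k) else 0).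
case: (boolp.pselect (exists i, n = k * e i)%N) => [[i ->] | no_i].
  by rewrite -ek dvdn_mulr // mulKn // !coef_sparse.
rewrite coef_sparse_eq0 => [|j]; last first.
  apply/eqP => ej; case: no_i; have [|i ji] := er j.
    by rewrite ej mulnC modnMDl modn_small.
  exists i; move: ej; rewrite ji ek => /addIn /eqP.
  by rewrite eqn_pmul2l // => /eqP.
case: ifP => // /dvdnP[b nb]; rewrite coef_sparse_eq0 // => j.
apply/eqP => ej; case: no_i; exists j.
by rewrite ej nb mulnK // mulnC.
Qed.

Lemma extract30_phi : extract 3 0 phi = dilate 3 phi.
Proof.
apply: (@extract_sparse_self 3 0 0) => //.
- exact: sqr_inj.
- exact: leq_sqr.
- by move=> i; rewrite addn0 expnMn mulnA addn0.
- by move=> i; rewrite addn0 muln_eq0 -signr_odd oddM signr_odd.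
- by move=> j /(proj2 (sqr_mod3 j)).
Qed.

Lemma extract32_phi : extract 3 2 phi = 0.
Proof. by apply: extract_sparse_eq0 => // j; case: (sqr_mod3 j). Qed.

Lemma extract96_phi : extract 9 6 phi = 0.
Proof.
by apply: extract_sparse_eq0 => // j; have := sqr_add_mod9 j 0; rewrite addn0.
Qed.

Lemma extract96_phi2 : extract 9 6 (phi ^+ 2) = 0.
Proof. by apply: extract_sparseM_eq0 => // i j; apply: sqr_add_mod9. Qed.

Lemma extract31_psi : extract 3 1 psi = dilate 3 psi.
Proof.
apply: (@extract_sparse_self 3 1 1) => //.
- exact: tri_inj.
- exact: leq_tri.
- exact: triD3.
- by move=> j /(proj2 (tri_mod3 j)).
Qed.

Lemma extract32_psi : extract 3 2 psi = 0.
Proof. by apply: extract_sparse_eq0 => // j; case: (tri_mod3 j). Qed.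

Lemma extract30_phi2 : extract 3 0 (phi ^+ 2) = dilate 3 phi ^+ 2.
Proof.
rewrite (extract_sqr3 phi (isT : (0 < 3)%N)) /= extract32_phi extract30_phi.
by rewrite mulr0 mul0rn addr0.
Qed.

Lemma extract32_psi2 : extract 3 2 (psi ^+ 2) = dilate 3 psi ^+ 2.
Proof.
rewrite (extract_sqr3 psi (isT : (2 < 3)%N)) /= extract32_psi extract31_psi.
by rewrite mulr0 mul0rn addr0.
Qed.

Lemma phi_1D2 : exists y, phi = 1 + y *+ 2.
Proof.
exists (sparse (fun k => k ^ 2)%N (fun k => if k == 0%N then 0 else (-1) ^+ k)).
apply: fpsP => n; rewrite fps_coefD fps_coefMn fps_coef1.
case: (boolp.pselect (exists k, k ^ 2 = n)%N) => [[k <-] | no_k].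
  rewrite !coef_sparse //; try exact: leq_sqr; try exact: sqr_inj.
  by rewrite expn_eq0 andbT; case: eqP => _; rewrite ?mul0rn ?addr0 ?add0r.
have ne k : (k ^ 2 != n)%N by apply/eqP => kn; case: no_k; exists k.
rewrite !coef_sparse_eq0 // mul0rn addr0; case: eqP => // n0.
by case: no_k; exists 0%N; rewrite n0.
Qed.

End SparseSections.

(** * Congruences modulo 4 and modulo 8 *)

Section PowersOfTwo.

Local Open Scope ring_scope.

Variable R : comNzRingType.
Local Notation phi := (phi R).
Local Notation P := (prod1D R).

Lemma fps_mulrn_eq0 k (f : fps R) : k%:R = 0 :> R -> f *+ k = 0.
Proof.
by move=> k0; apply: fpsP => n; rewrite fps_coefMn -mulr_natr k0 mulr0.
Qed.

(** When phi has the inverse f, the generating function is f up to a factor that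
    is a series in q^m, so it vanishes on every residue class modulo m on which f does. *)
Lemma extract_genA_eq0 m r (f : fps R) : (r < m)%N ->
  phi * f = 1 -> extract m r f = 0 -> extract m r (genA R m) = 0.
Proof.
move=> lt_rm phi_f f_r; apply: (mul_fps_inj (coef0_prod1D R)).
have m_gt0 := leq_ltn_trans (leq0n r) lt_rm.
have GE : genA R m * dilate m P = f.
  rewrite -[f]mul1r -(genA_phi R m_gt0) -[LHS]mulr1 -[X in _ * X = _]phi_f.
  by ring.
by rewrite mulrC -extractM // GE f_r mulr0.
Qed.

Lemma genA3_mod4 : 4%:R = 0 :> R -> extract 3 2 (genA R 3) = 0.
Proof.
move=> R4; apply: (@extract_genA_eq0 _ _ (1 *+ 2 - phi)) => //.
  have [y ->] := phi_1D2 R.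
  rewrite (_ : _ * _ = 1 - (y ^+ 2) *+ 4); last by ring.
  by rewrite fps_mulrn_eq0 ?subr0.
rewrite extractD extractN extractMn -monom0 extract_monom //= mul0rn add0r.
by rewrite extract32_phi oppr0.
Qed.

Lemma genA9_mod8 : 8%:R = 0 :> R -> extract 9 6 (genA R 9) = 0.
Proof.
move=> R8; apply: (@extract_genA_eq0 _ _ (1 *+ 3 - phi *+ 3 + phi ^+ 2)) => //.
  have [y ->] := phi_1D2 R.
  rewrite (_ : _ * _ = 1 + (y ^+ 3) *+ 8); last by ring.
  by rewrite fps_mulrn_eq0 ?addr0.
rewrite !extractD extractN !extractMn -monom0 extract_monom //=.
by rewrite extract96_phi extract96_phi2 !mul0rn oppr0 !addr0.
Qed.

End PowersOfTwo.

(** * Congruences modulo 3 *)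

Section ModuloThree.

Local Open Scope ring_scope.

Variable R : comNzRingType.
Hypothesis R3 : 3%:R = 0 :> R.
Local Notation phi := (phi R).
Local Notation psi := (psi R).
Local Notation D := (prod1B R).
Local Notation P := (prod1D R).

Lemma cube_1D_monom i (b : bool) :
  (1 + (-1) ^+ b * 'q^i) ^+ 3 = dilate 3 (1 + (-1) ^+ b * 'q^i) :> fps R.
Proof.
have s3 : ((-1) ^+ b : fps R) ^+ 3 = (-1) ^+ b by case: (b) => /=; ring.
have dil_s : dilate 3 ((-1) ^+ b) = (-1) ^+ b :> fps R.
  by case: (b); rewrite /= ?expr1 ?dilateN dilate1.
rewrite dilateD dilate1 // dilateM // dil_s dilate_monom //.
set s : fps R := (-1) ^+ b in s3 *; clearbody s.
rewrite (_ : 'q^(3 * i) = 'q^i ^+ 3); last by rewrite monomX mulnC.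
rewrite (_ : (1 + s * 'q^i) ^+ 3 = 1 + s ^+ 3 * 'q^i ^+ 3
  + (s * 'q^i + s ^+ 2 * 'q^i ^+ 2) *+ 3); last by ring.
by rewrite s3 fps_mulrn_eq0 ?addr0.
Qed.

Lemma cube_prod1B : D ^+ 3 = dilate 3 D.
Proof.
apply: cube_iprod => [|i]; first exact: admissible_1B_monom.
by rewrite -mulN1r (cube_1D_monom i true).
Qed.

Lemma cube_prod1D : P ^+ 3 = dilate 3 P.
Proof.
apply: cube_iprod => [|i]; first exact: admissible_1D_monom.
by rewrite -['q^i]mul1r (cube_1D_monom i false).
Qed.

Lemma psi_cube : psi ^+ 3 = dilate 3 psi.
Proof. by rewrite psi_eq_prod !dilateM // -cube_prod1B -cube_prod1D; ring. Qed.

Lemma psi_phi : psi = phi * dilate 3 P.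
Proof. by rewrite psi_eq_prod -phi_eq_prod -cube_prod1D; ring. Qed.

Lemma coef0_psi : coef psi 0 = 1.
Proof. by rewrite (coef_sparse _ 0 tri_inj leq_tri). Qed.

(** Modulo 3, P(q^3) is P^3, which leaves G_3 D P^3 = P. *)
Lemma genA3_psi : genA R 3 * psi = 1.
Proof.
apply: (mul_fps_inj (coef0_prod1D R)).
rewrite mulr1 -[RHS](genA_prod R (isT : (0 < 3)%N)).
by rewrite -cube_prod1D psi_eq_prod; ring.
Qed.

(** Modulo 3, P(q^9) is P^9, hence G_9 psi P^6 = 1, and psi = phi P^3. *)
Lemma genA9_psi : genA R 9 * dilate 3 psi = phi ^+ 2.
Proof.
have dil9 : dilate 9 P = P ^+ 9.
  rewrite -(dilate_dilate 3 P (isT : (0 < 3)%N)) -cube_prod1D dilateX //.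
  by rewrite -cube_prod1D -exprM.
have G9 : genA R 9 * psi * P ^+ 6 = 1.
  apply: (mul_fps_inj (coef0_prod1D R)); rewrite mulr1.
  rewrite -[RHS](genA_prod R (isT : (0 < 9)%N)) dil9 psi_eq_prod; ring.
by rewrite -psi_cube -[RHS]mul1r -G9 exprSr psi_phi -cube_prod1D; ring.
Qed.

(** With h = f psi, multiplying by psi^3 = psi(q^3) turns a division by psi into
    one by a series in q^3. *)
Lemma extract_psi r (f h : fps R) : (r < 3)%N ->
  f * psi = h -> extract 3 r f * psi = extract 3 r (h * psi ^+ 2).
Proof.
by move=> lt_r3 <-; rewrite -mulrA -exprS psi_cube extractM.
Qed.

(** The successive extractions are G_3 = 1 / psi, then psi(q^3)^2 / psi, then
    psi psi(q^3)^2, in which no exponent is 2 modulo 3. *)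
Lemma genA3_mod3 :
  extract 3 2 (extract 3 2 (extract 3 2 (genA R 3))) = 0.
Proof.
have G1 := extract_psi (isT : (2 < 3)%N) genA3_psi.
rewrite mul1r extract32_psi2 -dilateX // in G1.
have := extract_psi (isT : (2 < 3)%N) G1.
rewrite [dilate _ _ * _]mulrC extractM // extract32_psi2 -dilateX //.
set G2 := extract 3 2 (extract _ _ _) => G2psi.
have -> : G2 = psi * dilate 3 (psi ^+ 2).
  by apply: (mul_fps_inj coef0_psi); rewrite mulrC G2psi; ring.
by rewrite extractM // extract32_psi mul0r.
Qed.

(** The successive extractions are G_9 = phi^2 / psi(q^3), then phi(q^3)^2 / psi,
    then phi^2 psi(q^3)^2 / psi; here phi = psi / P(q^3), which leaves psi times
    a series in q^3. *)
Lemma genA9_mod3 :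
  extract 3 2 (extract 3 2 (extract 3 0 (genA R 9))) = 0.
Proof.
have : extract 3 0 (genA R 9) * psi = dilate 3 (phi ^+ 2).
  by rewrite dilateX // -extract30_phi2 -genA9_psi extractM.
move=> /(extract_psi (isT : (2 < 3)%N)).
rewrite [dilate _ _ * _]mulrC extractM // extract32_psi2 -dilateX //.
set G2 := extract 3 2 (extract _ _ _) => G2psi.
have {}G2psi : G2 * dilate 3 (P ^+ 2) = psi * dilate 3 (psi ^+ 2).
  have psi_sqr : psi ^+ 2 = phi ^+ 2 * dilate 3 (P ^+ 2).
    by rewrite psi_phi exprMn dilateX.
  apply: (mul_fps_inj coef0_psi).
  by rewrite mulrA [psi * G2]mulrC G2psi -mulrA -psi_sqr; ring.
apply: (mul_fps_inj (coef0X 2 (coef0_prod1D R))).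
by rewrite mulr0 mulrC -extractM // G2psi extractM // extract32_psi mul0r.
Qed.

End ModuloThree.

Lemma genA_dvd p m n : 1 < p -> coef (genA 'Z_p m) n = 0%R -> p %| A m n.
Proof.
by move=> p_gt1 /(congr1 val) /=; rewrite val_Zp_nat // => /eqP.
Qed.

Theorem theorem3p7 :
  forall n : nat,
    A 3 (27 * n + 26) = 0 %[mod 12] /\ A 9 (27 * n + 24) = 0 %[mod 24].
Proof.
move=> n; split; apply/eqP; rewrite mod0n -[_ == 0]/(_ %| _).
  rewrite (@Gauss_dvd 3 4) //; apply/andP; split; apply: genA_dvd => //.
    rewrite (_ : _ + _ = 3 * (3 * (3 * n + 2) + 2) + 2); last by lia.
    by have /(congr1 (fun f => coef f n)) := genA3_mod3 (pchar_Zp (isT : 1 < 3)).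
  rewrite (_ : _ + _ = 3 * (9 * n + 8) + 2); last by lia.
  by have /(congr1 (fun f => coef f (9 * n + 8))) := genA3_mod4 (pchar_Zp (isT : 1 < 4)).
rewrite (@Gauss_dvd 3 8) //; apply/andP; split; apply: genA_dvd => //.
  rewrite (_ : _ + _ = 3 * (3 * (3 * n + 2) + 2) + 0); last by lia.
  by have /(congr1 (fun f => coef f n)) := genA9_mod3 (pchar_Zp (isT : 1 < 3)).
rewrite (_ : _ + _ = 9 * (3 * n + 2) + 6); last by lia.
by have /(congr1 (fun f => coef f (3 * n + 2))) := genA9_mod8 (pchar_Zp (isT : 1 < 8)).
Qed.
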